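(* Let $H, K$ be complex Hilbert spaces, let $A \in CR(K,H)$ and $B \in CR(H,K)$, and let $$T = \begin{bmatrix} 0 & A \\ B & 0 \end{bmatrix} = \bigl\{\{(x,y),(y_a,x_b)\} : \{x,x_b\}\in B,\ \{y,y_a\}\in A\bigr\},$$ a linear relation from the domain $D(B)\times D(A)\subset H\times K$ into $H\times K$. Assume that $AB$ and $BA$ are closed linear relations in $H$ and $K$, respectively. Then $$\rho(T) = \{\lambda\in\mathbb{C} : \lambda^2\in\rho(AB)\cap\rho(BA)\},$$ where $\rho(T),\rho(AB),\rho(BA)$ are the resolvent sets of $T$, $AB$ and $BA$.
   Context: A linear relation from a Hilbert space $H$ into a Hilbert space $K$ is a linear subspace $T$ of $H\times K$, whose elements are written $\{x,y\}$; a linear relation in $H$ is one from $H$ into $H$. $CR(H,K)$ is the set of linear relations that are closed subspaces of $H\times K$. $D(T)=\{x:\{x,y\}\in T \text{ for some } y\}$, $T^{-1}=\{\{y,x\}:\{x,y\}\in T\}$, and $T$ is (the graph of) an operator if $\{0,y\}\in T$ implies $y=0$. Products: $TS=\{\{x,y\}: \{x,z\}\in S,\ \{z,y\}\in T \text{ for some } z\}$. For $\lambda\in\mathbb{C}$, $T-\lambda=\{\{x,y-\lambda x\}:\{x,y\}\in T\}$. For a closed linear relation $T$ in $H$, the resolvent set $\rho(T)$ is the set of $\lambda\in\mathbb{C}$ such that $(T-\lambda)^{-1}$ is a bounded operator with domain all of $H$. $H\times K$ is the Hilbert space direct sum with inner product $\langle (h_1,k_1),(h_2,k_2)\rangle=\langle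 h_1,h_2\rangle+\langle k_1,k_2\rangle$. *)

(* Defs.v *)
From HB Require Import structures.
From mathcomp Require Import all_boot all_order all_algebra.
From mathcomp Require Import sesquilinear complex ring.
From mathcomp Require Import boolp classical_sets reals topology normedtype.
Set Implicit Arguments.
Unset Strict Implicit.
Unset Printing Implicit Defensive.
Import Order.TTheory GRing.Theory Num.Theory.
Import numFieldNormedType.Exports.
Local Open Scope classical_set_scope.
Local Open Scope ring_scope.

HB.mixin Record NormedModule_hasInner (C : numClosedFieldType) U
    & NormedModule C U := {
  inner : {dot U for @Num.conj C} ;
  normr_inner : forall x : U, `|x| ^+ 2 = inner x x
}.

(* The complex Hilbert spaces are the instances with C := R[i], R : realType.
   [inner] is linear in its first argument and antilinear in the second. *)
#[short(type="hilbertType")]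
HB.structure Definition Hilbert (C : numClosedFieldType) :=
  {U of CompleteNormedModule C U & NormedModule_hasInner C U}.

(* The product of normed modules in the library carries the max norm, hence
   the alias, which carries the norm sqrt (|x|^2 + |y|^2). *)
Definition hsum (C : numClosedFieldType) (H K : hilbertType C) : Type :=
  (H * K)%type.

Notation "H \oplus K" := (hsum H K)
  (at level 50, left associativity, format "H  \oplus  K") : type_scope.

Section hilbert_sum.
Context {C : numClosedFieldType} (H K : hilbertType C).

HB.instance Definition _ := GRing.Lmodule.copy (H \oplus K) (H * K)%type.

Let norm (p : H \oplus K) : C := sqrtC (`|p.1| ^+ 2 + `|p.2| ^+ 2).

Let norm2 p : norm p ^+ 2 = `|p.1| ^+ 2 + `|p.2| ^+ 2.
Proof. by rewrite sqrtCK. Qed.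

Let norm_ge0 p : 0 <= norm p.
Proof. by rewrite sqrtC_ge0 addr_ge0// exprn_ge0. Qed.

Let normD (p q : H \oplus K) : norm (p + q) <= norm p + norm q.
Proof.
rewrite -(@ler_pXn2r _ 2) ?nnegrE ?addr_ge0// norm2.
set a := `|p.1|; set b := `|p.2|; set c := `|q.1|; set d := `|q.2|.
apply: (@le_trans _ _ ((a + c) ^+ 2 + (b + d) ^+ 2)).
  by apply: lerD; rewrite ler_pXn2r ?nnegrE ?addr_ge0 ?normr_ge0//= ler_normD.
suff h : a * c + b * d <= norm p * norm q.
  rewrite !sqrrD !norm2 -/a -/b -/c -/d.
  rewrite -subr_ge0.
  rewrite [leRHS](_ : _ = (norm p * norm q - (a * c + b * d)) *+ 2); last by ring.
  by rewrite mulrn_wge0// subr_ge0.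
rewrite -(@ler_pXn2r _ 2) ?nnegrE ?addr_ge0 ?mulr_ge0 ?normr_ge0//.
rewrite exprMn !norm2 -/a -/b -/c -/d -subr_ge0.
rewrite [leRHS](_ : _ = (a * d - b * c) ^+ 2); last by ring.
by rewrite real_exprn_even_ge0// rpredB// rpredM// normr_real.
Qed.

Let normZ (l : C) (p : H \oplus K) : norm (l *: p) = `|l| * norm p.
Proof.
apply/eqP; rewrite -(@eqrXn2 _ 2) ?mulr_ge0// exprMn !norm2 /=.
by rewrite !normrZ !exprMn mulrDr.
Qed.

Let norm_eq0 p : norm p = 0 -> p = 0.
Proof.
move=> p0; have := norm2 p; rewrite p0 expr0n/= => /esym/eqP.
rewrite paddr_eq0 ?exprn_ge0// !sqrf_eq0 !normr_eq0 => /andP[/eqP p1 /eqP p2].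
by case: p p1 p2 {p0} => x y /= -> ->.
Qed.

HB.instance Definition _ :=
  Lmodule_isNormed.Build C (H \oplus K) normD normZ norm_eq0.

Lemma hsum_normE (p : H \oplus K) : `|p| = sqrtC (`|p.1| ^+ 2 + `|p.2| ^+ 2).
Proof. by []. Qed.

Let norm1_le (p : H \oplus K) : `|p.1| <= `|p|.
Proof.
by rewrite -(@ler_pXn2r _ 2) ?nnegrE// norm2 lerDl exprn_ge0.
Qed.

Let norm2_le (p : H \oplus K) : `|p.2| <= `|p|.
Proof.
by rewrite -(@ler_pXn2r _ 2) ?nnegrE// norm2 lerDr exprn_ge0.
Qed.

Let norm_le (p : H \oplus K) : `|p| <= `|p.1| + `|p.2|.
Proof.
rewrite -(@ler_pXn2r _ 2) ?nnegrE ?addr_ge0// norm2 sqrrD.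
by rewrite addrAC lerDl mulrn_wge0// mulr_ge0.
Qed.

Let complete (F : set_system (H \oplus K)) : ProperFilter F -> cauchy F -> cvg F.
Proof.
move=> FF /cauchyP Fc.
have c1 : cauchy ((fst : H \oplus K -> H) @ F).
  apply/cauchyP => e e0; have [p Fp] := Fc _ e0; exists p.1.
  change (F (fst @^-1` ball p.1 e)).
  apply: filterS Fp => q /=; rewrite -!ball_normE /=.
  by move/(le_lt_trans (norm1_le (p - q))).
have c2 : cauchy ((snd : H \oplus K -> K) @ F).
  apply/cauchyP => e e0; have [p Fp] := Fc _ e0; exists p.2.
  change (F (snd @^-1` ball p.2 e)).
  apply: filterS Fp => q /=; rewrite -!ball_normE /=.
  by move/(le_lt_trans (norm2_le (p - q))).
have /cauchy_cvg/cvg_ex[x Fx] := c1.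
have /cauchy_cvg/cvg_ex[y Fy] := c2.
apply/cvg_ex; exists ((x, y) : H \oplus K).
apply/fcvg_ballP => e e0.
have e20 : 0 < e / 2 by rewrite divr_gt0.
move/cvg_ballP : Fx => /(_ _ e20) Fx; move/cvg_ballP : Fy => /(_ _ e20) Fy.
near=> q; rewrite -ball_normE /=.
apply: le_lt_trans (norm_le _) _; rewrite [ltRHS]splitr; apply: ltrD.
- have : ball x (e / 2) q.1 by near: q.
  by rewrite -ball_normE.
- have : ball y (e / 2) q.2 by near: q.
  by rewrite -ball_normE.
Unshelve. all: by end_near. Qed.

HB.instance Definition _ := Uniform_isComplete.Build (H \oplus K) complete.

Definition hsum_inner (p q : H \oplus K) : C :=
  inner p.1 q.1 + inner p.2 q.2.

Let hsum_inner_bilinear :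
  bilinear_for ( *%R : GRing.Scale.law C C)
    (Num.conj \; *%R : GRing.Scale.law C C) hsum_inner.
Proof.
split => [q a p p'|p a q q']; rewrite /hsum_inner /=.
  rewrite !linearDl !linearZl_LR /=; ring.
rewrite !linearDr !linearZr_LR /=; ring.
Qed.

HB.instance Definition _ :=
  bilinear_isBilinear.Build C (H \oplus K) (H \oplus K) C
    ( *%R : GRing.Scale.law C C)
    (Num.conj \; *%R : GRing.Scale.law C C) hsum_inner hsum_inner_bilinear.

Let hsum_inner_herm p q :
  hsum_inner p q = (-1) ^+ false * Num.conj (hsum_inner q p).
Proof.
rewrite mul1r rmorphD /hsum_inner.
by rewrite (hermC inner p.1) (hermC inner p.2) /= !mul1r.
Qed.

HB.instance Definition _ :=
  isHermitianSesquilinear.Build C (H \oplus K) false Num.conj hsum_inner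
    hsum_inner_herm.

Let normr_hsum_inner (p : H \oplus K) : `|p| ^+ 2 = hsum_inner p p.
Proof. by rewrite norm2 !normr_inner. Qed.

Let hsum_inner_gt0 (p : H \oplus K) : p != 0 -> 0 < hsum_inner p p.
Proof. by move=> p0; rewrite -normr_hsum_inner exprn_gt0// normr_gt0. Qed.

HB.instance Definition _ :=
  isDotProduct.Build C (H \oplus K) hsum_inner hsum_inner_gt0.

HB.instance Definition _ :=
  NormedModule_hasInner.Build C (H \oplus K) normr_hsum_inner.

Lemma hsum_innerE (p q : H \oplus K) :
  inner p q = inner p.1 q.1 + inner p.2 q.2.
Proof. by []. Qed.

End hilbert_sum.

Section linear_relations.
Context {C : numClosedFieldType}.
Implicit Types H K L : hilbertType C.

Definition linear_relation H K (T : set (H \oplus K)) : Prop :=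
  T 0 /\ forall (a : C) (p q : H \oplus K), T p -> T q -> T (a *: p + q).

Definition CR H K : set (set (H \oplus K)) :=
  [set T | linear_relation T /\ closed T].

Definition rel_dom H K (T : set (H \oplus K)) : set H :=
  [set x | exists y, T (x, y)].

Definition rel_inv H K (T : set (H \oplus K)) : set (K \oplus H) :=
  [set p | T (p.2, p.1)].

Definition is_operator H K (T : set (H \oplus K)) : Prop :=
  forall y, T (0, y) -> y = 0.

Definition bounded_rel H K (T : set (H \oplus K)) : Prop :=
  exists M : C, forall x y, T (x, y) -> `|y| <= M * `|x|.

(* The product [T S]: first [S], then [T]. *)
Definition rel_mul H K L (T : set (K \oplus L)) (S : set (H \oplus K)) :
    set (H \oplus L) :=
  [set p | exists z, S (p.1, z) /\ T (z, p.2)].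

Definition rel_sub H (T : set (H \oplus H)) (l : C) : set (H \oplus H) :=
  [set p | exists y, T (p.1, y) /\ p.2 = y - l *: p.1].

Definition resolvent_set H (T : set (H \oplus H)) : set C :=
  [set l | let S := rel_inv (rel_sub T l) in
    [/\ is_operator S, bounded_rel S & rel_dom S = setT]].

(* The block relation with first row 0, A and second row B, 0: its elements
   are the pairs ((x, y), (y_a, x_b)) with B (x, x_b) and A (y, y_a). *)
Definition offdiag H K (A : set (K \oplus H)) (B : set (H \oplus K)) :
    set ((H \oplus K) \oplus (H \oplus K)) :=
  [set p | B (p.1.1, p.2.2) /\ A (p.1.2, p.2.1)].

End linear_relations.

Arguments CR {C} H K _.

(* Main.v *)
Require Import Defs.
From mathcomp Require Import all_boot all_order all_algebra.
From mathcomp Require Import complex ring.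
From mathcomp Require Import boolp classical_sets filter reals topology.
From mathcomp Require Import normedtype.
Set Implicit Arguments.
Unset Strict Implicit.
Unset Printing Implicit Defensive.
Import Order.TTheory GRing.Theory Num.Theory.
Import numFieldNormedType.Exports.
Local Open Scope classical_set_scope.
Local Open Scope ring_scope.

(** Boundedness in the definition of the resolvent set is automatic. If [T] is
    closed, so is [(T - l)^-1], and the closed graph theorem makes an everywhere
    defined closed operator bounded. So [l] lies in the resolvent set of [T] as
    soon as [T - l] has trivial kernel and full range ([resolvent_setP]).
    Applied to the three closed relations [T], [AB] and [BA], this turns the
    theorem into algebra.

    That algebra rests on [T^2 = diag (AB, BA)] and the formal factorization
    [T^2 - l^2 = (T - l)(T + l)]. If [AB - l^2] and [BA - l^2] are bijective,
    then [(T + l) (T^2 - l^2)^-1] provides a solution of every equation for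
    [T - l] ([offdiag_surj]), and an element [(x, y)] of the kernel of [T - l]
    has [x] in the kernel of [AB - l^2] and [y] in that of [BA - l^2]
    ([offdiag_ker_eq0]). Conversely, for [l != 0], a chain [B (x, z)],
    [A (z, w + l^2 x)] says precisely that [T - l] relates [(x, z / l)] to
    [(w / l, 0)]; for [l = 0] one inverts [A] and [B] one after the other
    ([mul_ker_eq0], [mul_surj]). Exchanging [H] and [K] handles [BA].

    The closed graph theorem is proved for complex scalars. Say that [x] is
    nearly reached with bound [M] if arbitrarily close to [x] there are points
    having an image of norm at most [M]. A gliding hump shows that all points of
    some ball around 0 are nearly reached with bound 1 ([near_image_ball]);
    correcting the error again and again, with halved size, then reaches every
    point exactly, with a bound proportional to its norm ([closed_graph_ex]). *)

(** * Halving sequences *)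

Lemma halving_small (R : realType) (r : nat -> R[i]) (e : R[i]) :
  (forall n, 0 <= r n) -> (forall n, r n.+1 <= r n / 2) -> 0 < e ->
  exists n, r n < e.
Proof.
move=> r0 rS e0.
have rE n : (complex.Re (r n))%:C%C = r n by rewrite RRe_real// ger0_real.
have eE : (complex.Re e)%:C%C = e by rewrite RRe_real// gtr0_real.
have pow n : r n <= r 0%N / 2 ^+ n.
  elim: n => [|n IH]; first by rewrite expr0 divr1.
  apply: le_trans (rS n) _; rewrite exprSr invfM mulrA.
  by rewrite ler_pM2r// invr_gt0.
have s0 : 0 < complex.Re e by move: e0; rewrite -eE ltcR.
have le2 n : (n.+1%:R : R) <= 2 ^+ n by rewrite -natrX ler_nat ltn_expl.
pose n := Num.truncn (complex.Re (r 0%N) / complex.Re e).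
exists n; apply: le_lt_trans (pow n) _.
rewrite ltr_pdivrMr ?exprn_gt0//.
have : complex.Re (r 0%N) < complex.Re e * 2 ^+ n.
  rewrite mulrC -ltr_pdivrMr//; apply: lt_le_trans (le2 n).
  by rewrite truncnS_gt.
rewrite -ltcR rE; congr (_ < _).
by rewrite rmorphM rmorphXn/= eE rmorph_nat.
Qed.

(** The radii [r n] are chosen so that the closed balls of centre [x n] and
    radius [r n] are nested: the limit of the centres lies in all of them. *)
Lemma halving_cvg (R : realType) (E : completeNormedModType R[i])
    (x : nat -> E) (r : nat -> R[i]) :
  (forall n, 0 <= r n) -> (forall n, r n.+1 <= r n / 2) ->
  (forall n, `|x n.+1 - x n| <= r n / 2) ->
  exists l, forall n, `|l - x n| <= r n.
Proof.
move=> r0 rS xS.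
have near_x n k : `|x (k + n)%N - x n| <= r n - r (k + n)%N.
  elim: k => [|k IH]; first by rewrite add0n !subrr normr0.
  rewrite addSn; have -> : x (k + n).+1 - x n =
      (x (k + n).+1 - x (k + n)%N) + (x (k + n)%N - x n) by rewrite addrA subrK.
  apply: le_trans (ler_normD _ _) _.
  apply: le_trans (lerD (xS _) IH) _.
  have -> : r (k + n)%N / 2 + (r n - r (k + n)%N) = r n - r (k + n)%N / 2.
    by field.
  by rewrite lerD2l lerN2.
have ball_x n m : (n <= m)%N -> `|x m - x n| <= r n.
  move=> /subnK <-; apply: le_trans (near_x _ _) _.
  by rewrite gerBl.
have /cauchy_cvg/cvg_ex[l /cvgrPdist_lt xl] : cauchy (x @ \oo).
  apply: cauchy_exP => e e0; have [n rn] := halving_small r0 rS e0.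
  exists (x n); exists n => // m /= nm; rewrite -ball_normE /= distrC.
  exact: le_lt_trans (ball_x _ _ nm) rn.
exists l => n.
rewrite real_leNgt ?normr_real ?ger0_real//; apply/negP => lt.
have := xl (`|l - x n| - r n); rewrite subr_gt0.
move=> /(_ lt)[N _ /(_ (maxn N n))] /=.
rewrite leq_maxl => /(_ isT); have := ball_x n (maxn N n) (leq_maxr _ _).
set m := maxn N n => xm lm.
have := ler_normD (l - x m) (x m - x n); rewrite addrA subrK => le.
have := le_lt_trans le (ltr_leD lm xm); by rewrite subrK ltxx.
Qed.

(** * Closed relations *)

Lemma hsum_norm_fst (C : numClosedFieldType) (H K : hilbertType C)
    (p : H \oplus K) :
  `|p.1| <= `|p|.
Proof.
rewrite hsum_normE -(@ler_pXn2r _ 2) ?nnegrE ?sqrtC_ge0 ?addr_ge0 ?exprn_ge0//.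
by rewrite sqrtCK lerDl exprn_ge0.
Qed.

Lemma hsum_norm_snd (C : numClosedFieldType) (H K : hilbertType C)
    (p : H \oplus K) :
  `|p.2| <= `|p|.
Proof.
rewrite hsum_normE -(@ler_pXn2r _ 2) ?nnegrE ?sqrtC_ge0 ?addr_ge0 ?exprn_ge0//.
by rewrite sqrtCK lerDr exprn_ge0.
Qed.

Lemma hsum_norm_le (C : numClosedFieldType) (H K : hilbertType C)
    (p : H \oplus K) :
  `|p| <= `|p.1| + `|p.2|.
Proof.
rewrite hsum_normE -(@ler_pXn2r _ 2) ?nnegrE ?sqrtC_ge0 ?addr_ge0 ?exprn_ge0//.
by rewrite sqrtCK sqrrD addrAC lerDl mulrn_wge0// mulr_ge0.
Qed.

(** Closedness with the two components approximated separately, so that the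
    norm of the Hilbert sum no longer appears. *)
Lemma closed_relP (C : numClosedFieldType) (H K : hilbertType C)
    (T : set (H \oplus K)) :
  closed T <-> forall x y,
    (forall e : C, 0 < e -> exists x' y',
      [/\ T (x', y'), `|x - x'| <= e & `|y - y'| <= e]) -> T (x, y).
Proof.
split=> [cT x y Txy|cT [x y] Txy].
  apply: cT => B /nbhs_ballP[e /= e0 eB].
  have e20 : 0 < e / 4 by rewrite divr_gt0.
  have [x' [y' [Txy' xx' yy']]] := Txy _ e20.
  exists (x', y'); split=> //; apply: eB; rewrite -ball_normE /=.
  apply: le_lt_trans (hsum_norm_le _) _.
  apply: le_lt_trans (lerD xx' yy') _.
  have -> : e / 4 + e / 4 = e / 2 by field.
  by rewrite gtr_pMr// invf_lt1 ?ltr1n.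
apply: cT => e e0.
have [[x' y'] [Tp]] := Txy (ball ((x, y) : H \oplus K) e) (nbhsx_ballx _ _ e0).
rewrite -ball_normE /= => /ltW lt; exists x', y'; split=> //.
  exact: le_trans (hsum_norm_fst ((x, y) - (x', y') : H \oplus K)) lt.
exact: le_trans (hsum_norm_snd ((x, y) - (x', y') : H \oplus K)) lt.
Qed.

Lemma lin_relD (C : numClosedFieldType) (H K : hilbertType C)
    (T : set (H \oplus K)) x y x' y' :
  linear_relation T -> T (x, y) -> T (x', y') -> T (x + x', y + y').
Proof. by move=> [_ lT] t t'; have := lT 1 _ _ t t'; rewrite scale1r. Qed.

Lemma lin_relZ (C : numClosedFieldType) (H K : hilbertType C)
    (T : set (H \oplus K)) a x y :
  linear_relation T -> T (x, y) -> T (a *: x, a *: y).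
Proof. by move=> [T0 lT] t; have := lT a _ _ t T0; rewrite addr0. Qed.

Lemma lin_relB (C : numClosedFieldType) (H K : hilbertType C)
    (T : set (H \oplus K)) x y x' y' :
  linear_relation T -> T (x, y) -> T (x', y') -> T (x - x', y - y').
Proof.
move=> lT t t'; apply: (lin_relD lT t).
by have := lin_relZ (-1) lT t'; rewrite !scaleN1r.
Qed.

(** * The closed graph theorem *)

(** The points [x] such that [near_image T M x] form the closure of the set of
    those having an image of norm at most [M]. *)
Definition near_image (C : numClosedFieldType) (H K : hilbertType C)
    (T : set (H \oplus K)) (M : C) (x : H) :=
  forall e : C, 0 < e ->
    exists x' y', [/\ T (x', y'), `|x - x'| <= e & `|y'| <= M].

Section near_image_theory.
Context (C : numClosedFieldType) (H K : hilbertType C) (T : set (H \oplus K)).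
Hypothesis lT : linear_relation T.

Lemma near_imageZ (a M : C) (x : H) :
  near_image T M x -> near_image T (`|a| * M) (a *: x).
Proof.
move=> Tx e e0; have [->|a0] := eqVneq a 0.
  exists 0, 0; split; first exact: lT.1.
    by rewrite scale0r subrr normr0 ltW.
  by rewrite !normr0 mul0r.
have na0 : 0 < `|a| by rewrite normr_gt0.
have [x' [y' [t xx' y'M]]] := Tx (e / `|a|) (divr_gt0 e0 na0).
exists (a *: x'), (a *: y'); split; first exact: lin_relZ.
  by rewrite -scalerBr normrZ mulrC -ler_pdivlMr.
by rewrite normrZ ler_pM2l.
Qed.

(** The nearly reached points form a convex symmetric set, and [v] is half the
    difference of [x + v] and [x - v]. So if [v] is not nearly reached, one
    of [x + v] and [x - v] is not either, whatever [x] is. *)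
Lemma near_image_midpoint (M : C) (x v : H) :
  near_image T M (x + v) -> near_image T M (x - v) -> near_image T M v.
Proof.
move=> Tp Tm e e0.
have [x1 [y1 [t1 xx1 y1M]]] := Tp _ e0.
have [x2 [y2 [t2 xx2 y2M]]] := Tm _ e0.
have half (F : normedModType C) (a b : F) (d : C) :
    `|a| <= d -> `|b| <= d -> `|2^-1 *: (a - b)| <= d.
  move=> ad bd; rewrite normrZ ger0_norm ?invr_ge0// mulrC ler_pdivrMr//.
  by apply: le_trans (ler_normB _ _) _; rewrite mulr_natr mulr2n lerD.
exists (2^-1 *: (x1 - x2)), (2^-1 *: (y1 - y2)); split.
- by apply: (lin_relZ _ lT); apply: (lin_relB lT).
- rewrite [X in `|X|](_ : _ = 2^-1 *: ((x + v - x1) - (x - v - x2)));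
    first exact: half.
  have -> : x + v - x1 - (x - v - x2) = 2 *: v - (x1 - x2).
    rewrite scaler_nat mulr2n !opprB.
    by rewrite (AC (3*(1*2)) (((2*5)*(4*3))*(1*6)))/= subrr addr0.
  by rewrite [RHS]scalerBr scalerA mulVf ?scale1r ?pnatr_eq0.
- exact: half.
Qed.
End near_image_theory.

Section closed_graph.
Context (R : realType) (H K : hilbertType R[i]) (T : set (H \oplus K)).
Hypothesis lT : linear_relation T.
Hypothesis domT : rel_dom T = setT.

(** One hump: if points that are not nearly reached with bound 1 exist
    arbitrarily close to 0, then homogeneity gives small [v] that are not nearly
    reached with bound [n + 1]; moving [x] by [v] or [- v] leads to another such
    point, and a whole ball around it contains no point with an image of norm at
    most [n + 1]. *)
Lemma near_image_step (n : nat) (x : H) (s : R[i]) :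
  (forall r : R[i], 0 < r -> exists2 v, `|v| <= r & ~ near_image T 1 v) ->
  0 < s ->
  exists x' s', [/\ 0 < s', s' <= s / 2, `|x' - x| <= s / 2 &
    forall z y, `|x' - z| <= s' -> T (z, y) -> ~ `|y| <= n.+1%:R].
Proof.
move=> far s0.
have [|v0 v0s v0far] := far (s / 2 / n.+1%:R); first by rewrite !divr_gt0.
pose v := n.+1%:R *: v0.
have vfar : ~ near_image T n.+1%:R v.
  move=> /(near_imageZ lT n.+1%:R^-1).
  rewrite normfV normr_nat mulVf ?pnatr_eq0// scalerA mulVf ?pnatr_eq0//.
  by rewrite scale1r.
have vs : `|v| <= s / 2.
  by rewrite normrZ normr_nat mulrC -ler_pdivlMr.
have [x' x'x x'far] :
    exists2 x', `|x' - x| <= s / 2 & ~ near_image T n.+1%:R x'.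
  have [xp|xp] := pselect (near_image T n.+1%:R (x + v)).
    exists (x - v); first by rewrite addrAC subrr sub0r normrN.
    by move=> /(near_image_midpoint lT xp).
  by exists (x + v) => //; rewrite addrAC subrr add0r.
have [e e0 He] : exists2 e : R[i], 0 < e &
    forall z y, `|x' - z| <= e -> T (z, y) -> ~ `|y| <= n.+1%:R.
  move/existsNP: x'far => [e /not_implyP[e0 He]]; exists e => // z y xz t yn.
  by apply: He; exists z, y.
have s20 : 0 < s / 2 by rewrite divr_gt0.
have [es|/ltW se] := real_leP (gtr0_real e0) (gtr0_real s20).
  by exists x', e.
exists x', (s / 2); split=> // z y /le_trans /(_ se); exact: He.
Qed.

(** Otherwise the moved points converge to a point none of whose images has
    norm at most [n + 1], for any [n], although every point has an image. The
    argument is that of the Baire category theorem. *)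
Lemma near_image_ball :
  exists2 r : R[i], 0 < r & forall x, `|x| <= r -> near_image T 1 x.
Proof.
apply: contrapT => nball.
have far (r : R[i]) : 0 < r -> exists2 v, `|v| <= r & ~ near_image T 1 v.
  move=> r0; apply: contrapT => nv; apply: nball; exists r => // x xr.
  by apply: contrapT => nx; apply: nv; exists x.
have /choice[f Hf] : forall p : nat * (H * R[i]), exists q : H * R[i],
    0 < p.2.2 -> [/\ 0 < q.2, q.2 <= p.2.2 / 2, `|q.1 - p.2.1| <= p.2.2 / 2 &
    forall z y, `|q.1 - z| <= q.2 -> T (z, y) -> ~ `|y| <= p.1.+1%:R].
  move=> [n [x s]] /=; have [s0|] := boolP (0 < s); last by exists (0, 0).
  by have [x' [s' h]] := near_image_step n x far s0; exists (x', s').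
(* Centres and radii of the balls; the initial radius 1 is arbitrary. *)
pose u := fix u n := if n is m.+1 then f (m, u m) else ((0 : H), (1 : R[i])).
have u0 n : 0 < (u n).2.
  by elim: n => [|n IH] //=; have [] := Hf (n, u n) IH.
have uP n := Hf (n, u n) (u0 n).
have [l ul] : exists l, forall n, `|l - (u n).1| <= (u n).2.
  by apply: (halving_cvg (r := fun n => (u n).2)) => n;
    by [exact/ltW | have [] := uP n].
have [y Tly] : rel_dom T l by rewrite domT.
have [n yn] : exists n, `|y| <= n.+1%:R.
  have yE : (complex.Re `|y|)%:C%C = `|y| by apply: RRe_real; exact: normr_real.
  exists (Num.truncn (complex.Re `|y|)).
  by rewrite -yE -(rmorph_nat (real_complex R)) lecR ltW// truncnS_gt.
have [_ _ _ /(_ l y)] := uP n; apply=> //.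
by rewrite distrC; exact: (ul n.+1).
Qed.

Hypothesis cT : closed T.

(** Successive approximation: from [T (a, b)] with [|x - a| <= s / 2 ^ n], an
    element of [T] near [x - a] corrects [a] so that the error is halved, and
    moves [b] by at most [s / 2 ^ n / r]. The second components converge, and
    closedness of [T] makes their limit an image of [x]. *)
Lemma closed_graph_ex :
  exists M : R[i], forall x, exists2 y, T (x, y) & `|y| <= M * `|x|.
Proof.
have [r r0 Hr] := near_image_ball.
have near_s x s : 0 < s -> `|x| <= s -> near_image T (s / r) x.
  move=> s0 xs; have sr : 0 < s / r by rewrite divr_gt0.
  have := near_imageZ lT (s / r) (Hr ((s / r)^-1 *: x) _).
  rewrite scalerA divff ?gt_eqF// scale1r mulr1 gtr0_norm//; apply.
  rewrite normrZ gtr0_norm ?invr_gt0// invf_div mulrC mulrA ler_pdivrMr//.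
  by rewrite mulrC ler_pM2l.
(* 2 / r is the sum of the series of the corrections 1 / (2 ^ n * r). *)
exists (2 / r) => x; have [->|x0] := eqVneq x 0.
  by exists 0; [exact: lT.1|rewrite !normr0 mulr0].
set s := `|x|; have s0 : 0 < s by rewrite normr_gt0.
pose e n : R[i] := s / 2 ^+ n.
have e0 n : 0 < e n by rewrite divr_gt0// exprn_gt0.
have eS n : e n.+1 = e n / 2 by rewrite /e exprSr invfM mulrA.
have /choice[f Hf] : forall p : nat * (H * K), exists q : H * K,
    T p.2 -> `|x - p.2.1| <= e p.1 -> [/\ T q, `|x - q.1| <= e p.1.+1 &
      `|q.2 - p.2.2| <= e p.1 / r].
  move=> [n [a b]] /=.
  have [[t xa]|h] := pselect (T (a, b) /\ `|x - a| <= e n); last first.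
    by exists (0, 0) => t xa; case: h.
  have [x' [y' [t' xx' y'e]]] := near_s _ _ (e0 n) xa _ (e0 n.+1).
  exists (a + x', b + y') => _ _ /=; split.
  - exact: lin_relD.
  - by rewrite opprD addrA.
  - by rewrite addrAC subrr add0r.
pose u := fix u n := if n is m.+1 then f (m, u m) else ((0 : H), (0 : K)).
have uT n : T (u n) /\ `|x - (u n).1| <= e n.
  elim: n => [|n [IHt IHx]] /=.
    by split; [exact: lT.1|rewrite subr0 /e expr0 divr1].
  by have [] := Hf (n, u n) IHt IHx.
have uy n : `|(u n.+1).2 - (u n).2| <= e n / r.
  by have [t h] := uT n; have [] := Hf (n, u n) t h.
have [y yu] : exists y, forall n, `|y - (u n).2| <= 2 * (e n / r).
  apply: (halving_cvg (r := fun n => 2 * (e n / r))) => n.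
  - by rewrite mulr_ge0// divr_ge0// ltW.
  - by rewrite eS le_eqVlt; apply/orP; left; apply/eqP; field; rewrite gt_eqF.
  - by apply: le_trans (uy n) _; rewrite [leRHS]mulrC mulKf ?pnatr_eq0.
exists y; last first.
  by have := yu 0%N; rewrite /= subr0 /e expr0 divr1 mulrA mulrAC.
have /closed_relP := cT; apply=> d d0.
(* [m n] dominates the bounds [e n] and [2 * (e n / r)] on the distances of the
   components of [u n] to [x] and [y]. *)
pose m n := e n * (1 + 2 / r).
have k0 : 0 < 1 + 2 / r by rewrite addr_gt0// divr_gt0.
have [n mn] : exists n, m n < d.
  apply: (halving_small (r := m)) => // n; first by rewrite mulr_ge0// ltW.
  by rewrite /m eS mulrAC.
have [t h] := uT n; exists (u n).1, (u n).2; split.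
- by case: (u n) t.
- apply: le_trans h _; apply: le_trans (ltW mn).
  by rewrite ler_pMr// lerDl divr_ge0// ltW.
- apply: le_trans (yu n) _; apply: le_trans (ltW mn).
  by rewrite mulrA (mulrC 2) -mulrA ler_pM2l// lerDr.
Qed.

End closed_graph.

Theorem closed_graph (R : realType) (H K : hilbertType R[i])
    (T : set (H \oplus K)) :
  CR H K T -> is_operator T -> rel_dom T = setT -> bounded_rel T.
Proof.
move=> [lT cT] oT dT; have [M HM] := closed_graph_ex lT dT cT.
exists M => x y t; have [y' t' y'M] := HM x.
suff -> : y = y' by [].
apply/eqP; rewrite -subr_eq0; apply/eqP/oT.
by have := lin_relB lT t t'; rewrite subrr.
Qed.

(** * Resolvent sets *)

Section resolvent.
Context (C : numClosedFieldType).
Implicit Types H K : hilbertType C.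

Lemma rel_inv_subE H (T : set (H \oplus H)) l u x :
  rel_inv (rel_sub T l) (u, x) <-> T (x, u + l *: x).
Proof.
split=> [[y [t /= ->]]|t]; first by rewrite subrK.
by exists (u + l *: x); split=> //=; rewrite addrK.
Qed.

Lemma CR_rel_inv_sub H (T : set (H \oplus H)) l :
  CR H H T -> CR H H (rel_inv (rel_sub T l)).
Proof.
move=> [lT /closed_relP cT]; split; last first.
  apply/closed_relP => u x ux; apply/rel_inv_subE/cT => e e0.
  have k0 : 0 < 1 + `|l| by rewrite ltr_pwDl.
  have [u' [x' [/rel_inv_subE t uu' xx']]] := ux _ (divr_gt0 e0 k0).
  exists x', (u' + l *: x'); split=> //.
    by apply: le_trans xx' _; rewrite ler_pdivrMr// ler_peMr ?lerDl// ltW.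
  have -> : u + l *: x - (u' + l *: x') = (u - u') + l *: (x - x').
    by rewrite scalerBr opprD addrACA.
  apply: le_trans (ler_normD _ _) _; rewrite normrZ.
  apply: le_trans (lerD uu' (ler_wpM2l (normr_ge0 l) xx')) _.
  by rewrite -[X in X + _]mul1r -mulrDl mulrC divfK ?gt_eqF.
split; first by apply/rel_inv_subE; rewrite scaler0 addr0; exact: lT.1.
move=> a [u x] [v y] /rel_inv_subE ux /rel_inv_subE vy; apply/rel_inv_subE.
have := lin_relD lT (lin_relZ a lT ux) vy.
by rewrite !scalerDr scalerA mulrC -scalerA addrACA.
Qed.

Lemma CR_offdiag H K (A : set (K \oplus H)) (B : set (H \oplus K)) :
  CR K H A -> CR H K B -> CR (H \oplus K) (H \oplus K) (offdiag A B).
Proof.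
move=> [lA /closed_relP cA] [lB /closed_relP cB]; split; last first.
  apply/closed_relP => p q pq; split=> /=; [apply: cB|apply: cA] => e e0;
    have [p' [q' [[/= b a] pp' qq']]] := pq e e0.
    exists p'.1, q'.2; split=> //.
      exact: le_trans (hsum_norm_fst (p - p')) pp'.
    exact: le_trans (hsum_norm_snd (q - q')) qq'.
  exists p'.2, q'.1; split=> //.
    exact: le_trans (hsum_norm_snd (p - p')) pp'.
  exact: le_trans (hsum_norm_fst (q - q')) qq'.
split; first by split; [exact: lB.1|exact: lA.1].
move=> c p q [pB pA] [qB qA]; split.
  exact: lin_relD lB (lin_relZ c lB pB) qB.
exact: lin_relD lA (lin_relZ c lA pA) qA.
Qed.

End resolvent.

(** The boundedness clause is supplied by the closed graph theorem, applied to
    [(T - l)^-1], which is closed because [T] is. *)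
Lemma resolvent_setP (R : realType) (H : hilbertType R[i])
    (T : set (H \oplus H)) (l : R[i]) :
  CR H H T -> resolvent_set T l <->
    (forall x, T (x, l *: x) -> x = 0) /\
    (forall u, exists x, T (x, u + l *: x)).
Proof.
move=> crT; have kerE x : rel_inv (rel_sub T l) (0, x) <-> T (x, l *: x).
  by rewrite rel_inv_subE add0r.
split=> [[op _ dom]|[ker surj]].
  split=> [x /kerE/op//|u]; have : setT u by [].
  by rewrite -dom => -[x /rel_inv_subE]; exists x.
have op : is_operator (rel_inv (rel_sub T l)) by move=> x /kerE/ker.
have dom : rel_dom (rel_inv (rel_sub T l)) = setT.
  by rewrite -subTset => u _; have [x /rel_inv_subE] := surj u; exists x.
by split=> //; apply: closed_graph => //; exact: CR_rel_inv_sub.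
Qed.

(** * The off-diagonal relation *)

Section offdiag_algebra.
Context (C : numClosedFieldType) (H K : hilbertType C).
Context (A : set (K \oplus H)) (B : set (H \oplus K)).
Hypotheses (lA : linear_relation A) (lB : linear_relation B).
Variable l : C.

(** A chain [B (x, z)], [A (z, l^2 x)] makes [(x, z / l)] an element of the
    kernel of [T - l]. For [l = 0] the chain gives [z = 0], then [x = 0]. *)
Lemma mul_ker_eq0 :
  (forall p, offdiag A B (p, l *: p) -> p = 0) ->
  forall x, rel_mul A B (x, l ^+ 2 *: x) -> x = 0.
Proof.
move=> ker x [z [/= b a]]; have [l0|l0] := eqVneq l 0.
  move: a; rewrite l0 expr0n scale0r => a.
  have [z0] : ((0, z) : H \oplus K) = 0.
    by apply: ker; split=> /=; rewrite l0 scale0r//; exact: lB.1.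
  have [] // : ((x, 0) : H \oplus K) = 0.
  by apply: ker; split=> /=; rewrite l0 scale0r -?z0//; exact: lA.1.
have [] // : ((x, l^-1 *: z) : H \oplus K) = 0.
apply: ker; split=> /=; first by rewrite scalerA divff// scale1r.
by have := lin_relZ l^-1 lA a; rewrite scalerA expr2 mulKf.
Qed.

(** Solving for [(w / l, 0)] gives [(x, y)] with [B (x, l y)], and [l y] is the
    intermediate point of the chain from [x] to [w + l^2 x]. For [l = 0] the
    intermediate point comes from solving with [A], and [x] from solving with
    [B]. *)
Lemma mul_surj :
  (forall w, exists p, offdiag A B (p, w + l *: p)) ->
  forall w, exists x, rel_mul A B (x, w + l ^+ 2 *: x).
Proof.
move=> surj w; have [l0|l0] := eqVneq l 0.
  have [[x1 z] [_ /= a]] := surj ((w, 0) : H \oplus K).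
  have [[x y1] [/= b _]] := surj ((0, z) : H \oplus K).
  exists x, z; split=> /=.
    by move: b; rewrite l0 scale0r addr0.
  by move: a; rewrite l0 expr0n !scale0r.
have [[x y] [/= b a]] := surj ((l^-1 *: w, 0) : H \oplus K).
exists x, (l *: y); split=> /=; first by move: b; rewrite add0r.
by have := lin_relZ l lA a; rewrite scalerDr !scalerA divff// scale1r expr2.
Qed.

(** If [B (x, l y)] and [A (y, l x)], then scaling one of them by [l] makes them
    composable, in either order. *)
Lemma offdiag_ker_eq0 :
  (forall x, rel_mul A B (x, l ^+ 2 *: x) -> x = 0) ->
  (forall y, rel_mul B A (y, l ^+ 2 *: y) -> y = 0) ->
  forall p, offdiag A B (p, l *: p) -> p = 0.
Proof.
move=> kAB kBA [x y] [/= b a].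
have -> : x = 0.
  apply: kAB; exists (l *: y); split=> //=.
  by have := lin_relZ l lA a; rewrite scalerA -expr2.
have -> // : y = 0.
apply: kBA; exists (l *: x); split=> //=.
by have := lin_relZ l lB b; rewrite scalerA -expr2.
Qed.

Lemma offdiag_surj :
  (forall u, exists x, rel_mul A B (x, u + l ^+ 2 *: x)) ->
  (forall v, exists y, rel_mul B A (y, v + l ^+ 2 *: y)) ->
  forall w, exists p, offdiag A B (p, w + l *: p).
Proof.
move=> sAB sBA [u v].
have [x [z [/= bx az]]] := sAB u; have [y [w [/= ay bw]]] := sBA v.
(* The solution is [(T + l) (T^2 - l^2)^-1 (u, v)]: here
   [(x, y) = (T^2 - l^2)^-1 (u, v)] and [T ((x, y), (w, z))]. *)
exists ((l *: x + w, z + l *: y) : H \oplus K); split=> /=.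
  have := lin_relD lB (lin_relZ l lB bx) bw.
  by rewrite scalerDr scalerA -expr2 addrCA.
have := lin_relD lA az (lin_relZ l lA ay).
by rewrite scalerDr scalerA -expr2 addrA.
Qed.

End offdiag_algebra.

Theorem theorem4p1 (R : realType) (H K : hilbertType R[i])
    (A : set (K \oplus H)) (B : set (H \oplus K))
    (hA : CR K H A) (hB : CR H K B)
    (hAB : CR H H (rel_mul A B)) (hBA : CR K K (rel_mul B A)) :
  resolvent_set (offdiag A B) =
  [set l : R[i] | (resolvent_set (rel_mul A B) `&` resolvent_set (rel_mul B A))
                    (l ^+ 2)].
Proof.
have [lA _] := hA; have [lB _] := hB.
have hT := CR_offdiag hA hB.
apply/seteqP; split=> l.
  move=> /(resolvent_setP l hT)[ker surj].
  split; apply/resolvent_setP => //; split.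
  - exact: mul_ker_eq0 lA lB _ ker.
  - exact: mul_surj lA _ surj.
  - apply: (mul_ker_eq0 lB lA) => -[y x] [/= a b].
    by have [-> ->] := ker ((x, y) : H \oplus K) (conj b a).
  - apply: (mul_surj lB) => -[v u].
    have [[x y] [/= b a]] := surj ((u, v) : H \oplus K).
    by exists ((y, x) : K \oplus H).
move=> -[/(resolvent_setP _ hAB)[kAB sAB] /(resolvent_setP _ hBA)[kBA sBA]].
apply/resolvent_setP => //; split.
  exact: offdiag_ker_eq0 lA lB _ kAB kBA.
exact: offdiag_surj lA lB _ sAB sBA.
Qed.
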